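(* Let $G$ be a finite simple undirected graph with at least three vertices. If $G$ is $3$-tough and $2K_2$-free, then $G$ is hamiltonian, i.e., $G$ contains a cycle passing through every vertex of $G$.
   Context: All graphs are finite, simple and undirected. For a graph $G$ and $S\subseteq V(G)$, $G-S$ denotes the subgraph of $G$ induced by $V(G)\setminus S$, and $c(G)$ denotes the number of connected components of $G$. For a real number $t\ge 0$, $G$ is called $t$-tough if $|S|\ge t\cdot c(G-S)$ for every $S\subseteq V(G)$ with $c(G-S)\ge 2$ (in particular, complete graphs are $t$-tough for every $t$). A graph is called $2K_2$-free if it does not contain two independent edges as an induced subgraph, i.e., there are no four distinct vertices $a,b,c,d$ such that $ab$ and $cd$ are edges and none of $ac,ad,bc,bd$ is an edge. *)

(* Defs.v *)
From HB Require Import structures.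
From mathcomp Require Import all_boot all_order all_algebra.
From mathcomp Require Import reals.

Set Implicit Arguments.
Unset Strict Implicit.
Unset Printing Implicit Defensive.

Import Order.TTheory GRing.Theory Num.Theory.
Local Open Scope ring_scope.

Record sgraph := SGraph {
  vertex :> finType;
  adj : rel vertex;
  adj_sym : symmetric adj;
  adj_irrefl : irreflexive adj
}.

Section Induced.
Variables (G : sgraph) (A : {set G}).

Definition induced_adj : rel {x : G | x \in A} := relpre val (@adj G).

Lemma induced_adj_sym : symmetric induced_adj.
Proof. by move=> x y; apply: adj_sym. Qed.

Lemma induced_adj_irrefl : irreflexive induced_adj.
Proof. by move=> x; apply: adj_irrefl. Qed.

Definition induced : sgraph := SGraph induced_adj_sym induced_adj_irrefl.
End Induced.

Definition delete_vertices (G : sgraph) (S : {set G}) : sgraph :=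
  induced (~: S).

Definition num_components (G : sgraph) : nat := n_comp (@adj G) G.

Definition tough (R : realType) (t : R) (G : sgraph) : Prop :=
  forall S : {set G},
    (2 <= num_components (delete_vertices S))%N ->
    t * (num_components (delete_vertices S))%:R <= #|S|%:R.

Definition two_K2_free (G : sgraph) : Prop :=
  ~ exists a b c d : G,
      [/\ uniq [:: a; b; c; d], adj a b, adj c d
        & [/\ ~~ adj a c, ~~ adj a d, ~~ adj b c & ~~ adj b d]].

(* A graph cycle has length at least 3; [ucycle] alone also accepts the
   empty sequence and a single edge traversed back and forth. *)
Definition graph_cycle (G : sgraph) (p : seq G) : Prop :=
  (3 <= size p)%N /\ ucycle (@adj G) p.

Definition hamiltonian (G : sgraph) : Prop :=
  exists p : seq G, graph_cycle p /\ forall x : G, x \in p.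

(* Main.v *)
Require Import Defs.
From mathcomp Require Import all_boot all_order all_algebra.
From mathcomp Require Import reals.
From mathcomp Require Import zify.

Set Implicit Arguments.
Unset Strict Implicit.
Unset Printing Implicit Defensive.
Import Order.TTheory GRing.Theory Num.Theory.

(** Write [n] for the number of vertices, and assume that the graph is not
    complete.  Toughness [3] bounds every independent set by [n / 4]
    ([independent_card]).  In a [2K_2]-free graph the vertices adjacent to
    neither end of an edge form an independent set, so the degrees of two
    adjacent vertices add up to at least [3n / 4] ([edge_degrees]).  Call a
    vertex light if its degree is at most [n / 4] and heavy if it is at least
    [n / 2]: the neighbours of a light vertex are all heavy.

    By Ore's exchange argument, adding all edges between heavy vertices does
    not affect hamiltonicity ([ore_closure]).  In the resulting graph
    [heavy_adj] the heavy vertices form a clique, and toughness together with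
    Hall's theorem gives each light vertex two private heavy neighbours; the
    paths of three vertices so obtained are linked through the clique into a
    cycle that contains all light vertices ([cycle_through_light]).

    Let [p] be a longest cycle containing all light vertices, and suppose that
    it misses [w] ([longest_spanning]).  Let [I] be the component of [w] outside
    [p], [A] the set of vertices of [p] adjacent to [I], and [B] the set of
    successors of [A] along [p].  By the usual exchanges, [A] and [B] are
    disjoint and [B] plus [w] is independent, so [A] has fewer than [n / 4]
    vertices.  Since [w] is not light, it has more neighbours than that, hence
    an edge inside [I].  By [2K_2]-freeness against this edge, every vertex of
    [p] outside [A] has all its neighbours in [A]; it is therefore light, its
    predecessor on [p] is a genuine neighbour, and so it belongs to [B].  Thus
    removing [A] isolates all of [B], as well as leaving [w], although [B] is
    as large as [A]: this contradicts toughness. *)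

(** * Hall's theorem *)

(** The induction of Halmos and Vaughan: either some proper subset [S] is tight,
    and then [S] and its complement can be matched separately, or every proper
    subset has slack, and then any single choice can be made greedily.  Since
    [f] is total, [T2] has to be inhabited, whence [y0]. *)
Lemma hall (T1 T2 : finType) (y0 : T2) (N : T1 -> {set T2}) (X : {set T1}) :
    (forall S : {set T1}, S \subset X -> #|S| <= #|\bigcup_(x in S) N x|) ->
  exists f : T1 -> T2, {in X &, injective f} /\ {in X, forall x, f x \in N x}.
Proof.
have [m] := ubnP #|X|; elim: m => // m IH in N X *; rewrite ltnS => leXm hallX.
have [->|[x0 x0X]] := set_0Vmem X.
  by exists (fun=> y0); split=> x; rewrite inE.
have bigD (M : {set T2}) (S : {set T1}) :
    \bigcup_(x in S) (N x :\: M) = (\bigcup_(x in S) N x) :\: M.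
  apply/setP=> y; rewrite inE; apply/bigcupP/andP => [[x xS]|[yM /bigcupP[x xS yN]]].
    by rewrite inE => /andP[-> yN]; split=> //; apply/bigcupP; exists x.
  by exists x; rewrite // inE yM.
have [/existsP[S /and4P[SX S0 SnX /eqP tightS]]|/existsPn slack] :=
  boolP [exists S : {set T1},
    [&& S \subset X, S != set0, S != X & #|\bigcup_(x in S) N x| == #|S|]].
- have SpX : S \proper X by rewrite properEneq SnX.
  have ltSX := leq_trans (proper_card SpX) leXm.
  have [|f1 [inj1 N1]] := IH N S ltSX.
    by move=> S' S'S; apply/hallX/(subset_trans S'S).
  have [||f2 [inj2 N2]] := IH (fun x => N x :\: \bigcup_(x in S) N x) (X :\: S).
  + apply: leq_trans leXm; rewrite cardsD (setIidPr SX) ltn_subrL.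
    by rewrite !card_gt0 S0; apply/set0Pn; exists x0.
  + move=> S' /subsetDP[S'X dSS']; rewrite bigD.
    have := hallX (S :|: S'); rewrite subUset SX S'X => /(_ isT).
    rewrite cardsU (_ : S :&: S' = set0) ?cards0 ?subn0; last first.
      by apply/eqP; rewrite setI_eq0 disjoint_sym.
    rewrite bigcup_setU -tightS => /leq_trans.
    rewrite -(leq_add2l #|\bigcup_(x in S) N x|); apply.
    by rewrite cardsU cardsD setIC addnBA // subset_leq_card ?subsetIl.
  exists (fun x => if x \in S then f1 x else f2 x).
  have f2N x : x \in X -> x \notin S -> f2 x \in N x :\: \bigcup_(x in S) N x.
    by move=> xX xS; apply: N2; rewrite inE xS.
  have f1S x : x \in S -> f1 x \in \bigcup_(x in S) N x.
    by move=> xS; apply/bigcupP; exists x; rewrite ?N1.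
  split=> [x z xX zX|x xX]; last first.
    by case: ifP => [/N1 //|/negbT /(f2N _ xX)]; rewrite inE => /andP[].
  case: ifPn => xS; case: ifPn => zS.
  + exact: inj1.
  + by move=> eqf; have := f2N _ zX zS; rewrite -eqf inE f1S.
  + by move=> eqf; have := f2N _ xX xS; rewrite eqf inE f1S.
  + by apply: inj2; rewrite inE ?xS ?zS.
have /card_gt0P[y yN] : 0 < #|N x0|.
  by have := hallX [set x0]; rewrite sub1set big_set1 cards1; apply.
have [||f [injf fN]] := IH (fun x => N x :\ y) (X :\ x0).
- by move: leXm; rewrite (cardsD1 x0) x0X.
- move=> S SX; have [->|S0] := eqVneq S set0; first by rewrite cards0.
  have /subsetD1P[SX' x0S] := SX.
  rewrite bigD; have := slack S; rewrite SX' S0.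
  have -> /= : S != X by apply: contraNneq x0S => ->.
  have := hallX S SX'; rewrite leq_eqVlt eq_sym => /orP[->//|lt _].
  by move: lt; rewrite (cardsD1 y); case: (y \in _) => // /ltnW.
exists (fun x => if x == x0 then y else f x).
have fx x : x \in X -> x != x0 -> f x \in N x :\ y.
  by move=> xX ne; apply: fN; rewrite !inE ne.
split=> [x z xX zX|x xX]; last first.
  by case: eqP => [->//|/eqP /(fx _ xX)]; rewrite inE => /andP[].
case: eqVneq => [->|nx]; case: eqVneq => [->//|nz].
- by move=> eqf; have := fx _ zX nz; rewrite -eqf !inE eqxx.
- by move=> eqf; have := fx _ xX nx; rewrite eqf !inE eqxx.
- by apply: injf; rewrite !inE ?nx ?nz.
Qed.


(** * Cycle exchanges *)

Lemma cycle_cat (T : Type) (e : rel T) x p y q :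
  cycle e ((x :: p) ++ (y :: q)) =
    [&& path e x p, e (last x p) y, path e y q & e (last y q) x].
Proof. by rewrite /= rcons_cat cat_path /= rcons_path. Qed.

Lemma ucycle_complete (T : eqType) (e : rel T) (p : seq T) :
  (forall x y, x != y -> e x y) -> uniq p -> 1 < size p -> ucycle e p.
Proof.
move=> ce; case: p => [|x [|y p]] // Up _; rewrite /ucycle Up andbT /=.
have /= : path e x (y :: p).
  have : pairwise e (x :: y :: p).
    by move: Up; rewrite uniq_pairwise; apply: sub_pairwise.
  by move/pairwise_sorted.
rewrite rcons_path => /andP[-> ->] /=; apply: ce.
have : last y p \in y :: p by apply: mem_last.
by apply: contraTneq => ->; case/andP: Up.
Qed.

Section Exchange.
Variables (T : finType) (e : rel T).
Hypothesis sym_e : symmetric e.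

(** Deleting the edges that leave [x] and [y] cuts a cycle into two paths. *)
Lemma cycle_split (p : seq T) x y :
    uniq p -> x \in p -> y \in p -> x != y ->
  exists i q1 q2, [/\ rot i p = (next p x :: q1) ++ (next p y :: q2),
    last (next p x) q1 = y & last (next p y) q2 = x].
Proof.
move=> Up xp yp nexy.
have nne : next p x != next p y by rewrite (can_eq (prev_next Up)).
have [|| i q1 q2 _ _ def_p] := rot_to_arc Up _ _ nne; rewrite ?mem_next //.
exists i, q1, q2; have := cycle_next Up.
rewrite -(rot_cycle i) def_p cycle_cat.
have inj_next := can_inj (prev_next Up).
by case/and4P=> _ /eqP/inj_next-> _ /eqP/inj_next->.
Qed.

(** The two paths obtained by cutting a cycle can be closed up again with the
    second one reversed: their first vertices are joined directly, their last
    vertices through [s].  With [s] empty this is Ore's exchange; otherwise it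
    lengthens the cycle. *)
Lemma ucycle_cross x p s y q :
    uniq ((x :: p) ++ s ++ (y :: q)) -> path e x p -> path e y q -> e x y ->
    path e (last x p) s -> e (last (last x p) s) (last y q) ->
  ucycle e ((x :: p) ++ s ++ rev (y :: q)).
Proof.
move=> U pp pq exy ps el; rewrite /ucycle andbC; apply/andP; split.
  rewrite (perm_uniq (s2 := (x :: p) ++ s ++ (y :: q))) //.
  by rewrite !perm_cat2l perm_rev.
rewrite [y :: q]lastI rev_rcons catA cat_cons.
rewrite cycle_cat cat_path pp ps last_cat el /= rev_path.
rewrite (eq_path (e' := e)) // pq /=.
by case: (q) => [|z q'] /=; rewrite ?rev_cons ?last_rcons sym_e.
Qed.

(** A path from [x] to [y] with at least one interior vertex, all of whose
    interior vertices [u :: s] avoid [p]. *)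
Definition detour (p : seq T) (x y : T) := exists u s,
  [/\ e x u, path e u s, e (last u s) y & uniq ((u :: s) ++ p)].

Variable p : seq T.
Hypothesis (ucp : ucycle e p).
Hypothesis longest :
  forall p', ucycle e p' -> {subset p <= p'} -> size p' <= size p.

Lemma no_longer u s p' : perm_eq p' ((u :: s) ++ p) -> ~ ucycle e p'.
Proof.
move=> permp ucp'.
have := longest ucp'; rewrite (perm_size permp) /= size_cat => le_p.
have /le_p : {subset p <= p'}.
  by move=> z zp; rewrite (perm_mem permp) mem_cat zp orbT.
by lia.
Qed.

Lemma no_insertion x : x \in p -> ~ detour p x (next p x).
Proof.
move=> xp [u [s [exu us sx Us]]]; have /andP[cp Up] := ucp.
have [|i q def_p] := @rot_to _ p (next p x); first by rewrite mem_next.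
have lq : last (next p x) q = x.
  have := cycle_next Up; rewrite -(rot_cycle i) def_p /= rcons_path.
  by case/andP=> _ /eqP/(can_inj (prev_next Up)).
have permq : perm_eq (rot i p ++ (u :: s)) ((u :: s) ++ p).
  by rewrite perm_catC perm_cat2l perm_rot.
apply: (no_longer permq).
rewrite /ucycle (perm_uniq permq) Us andbT.
move: cp; rewrite -(rot_cycle i) def_p cycle_cat lq exu us sx /= rcons_path.
by case/andP=> ->.
Qed.

Lemma no_crossing x y : x \in p -> y \in p -> x != y ->
  detour p y x -> ~~ e (next p x) (next p y).
Proof.
move=> xp yp nexy [u [s [eyu us sx Us]]]; have /andP[cp Up] := ucp.
apply/negP=> exy.
have [i [q1 [q2 [def_p l1 l2]]]] := cycle_split Up xp yp nexy.
move: (cp); rewrite -(rot_cycle i) def_p cycle_cat.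
move=> /and4P[p1 _ p2 _].
set p1' := next p x :: q1 in def_p *; set p2' := next p y :: q2 in def_p *.
have permq : perm_eq (p1' ++ (u :: s) ++ p2') ((u :: s) ++ p).
  by rewrite perm_catCA perm_cat2l -def_p perm_rot.
have permq' : perm_eq (p1' ++ (u :: s) ++ rev p2') ((u :: s) ++ p).
  by rewrite -(permPr permq) !perm_cat2l perm_rev.
apply: (no_longer permq'); apply: ucycle_cross => //.
- by rewrite (perm_uniq permq).
- by rewrite l1 /= eyu.
- by rewrite l1 l2.
Qed.
End Exchange.

(** * Ore's closure *)

Section Ore.
Variables (T : finType) (e : rel T).
Hypothesis (sym_e : symmetric e) (irr_e : irreflexive e).

Definition add_edge x y : rel T :=
  fun a b => [|| e a b, (a == x) && (b == y) | (a == y) && (b == x)].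

(** A path with at least three vertices cannot use an edge joining its ends. *)
Lemma path_add_edge x q : uniq (x :: q) -> 1 < size q ->
  path (add_edge x (last x q)) x q -> path e x q.
Proof.
case: q => [|t [|t' q]] // Uq _.
set y := last _ _; have yq : y \in t' :: q by rewrite /y /= mem_last.
rewrite [path _ _ _]/= -/(path _ t (t' :: q)) => /andP[xt tq].
have /= /andP[xnot /andP[tnot _]] := Uq.
have nyx : y != x by apply: contraNneq xnot => <-; rewrite in_cons yq orbT.
have nyt : y != t by apply: contraNneq tnot => <-.
apply/andP; split.
  move: xt; rewrite /add_edge (eq_sym t) (negbTE nyt) andbF.
  by rewrite eq_sym (negbTE nyx) !orbF.
apply: (sub_in_path (P := [pred a | a != x]) (e := add_edge x y)) tq.
  move=> a b; rewrite !inE => /negbTE ax /negbTE bx.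
  by rewrite /add_edge ax bx andbF !orbF.
by apply/allP=> a aq; rewrite inE; apply: contraNneq xnot => <-.
Qed.

(** Two vertices joined by an edge form a closed sequence as well, so that this
    is hamiltonicity only on a type with at least three elements. *)
Definition ham (r : rel T) := exists p, ucycle r p /\ forall x, x \in p.

(** If the cycle runs through the new edge from [z] to [next p z], the degree
    condition forces some [v] with [v] adjacent to [z] and [next p v] adjacent
    to [next p z], by counting inside the complement of [z]; the exchange at
    [z] and [v] then avoids the new edge. *)
Lemma ore_step x y :
    2 < #|T| -> x != y -> #|T| <= #|[set z | e x z]| + #|[set z | e y z]| ->
  ham (add_edge x y) -> ham e.
Proof.
move=> T3 + + [p [/andP[cp Up] p_all]].
have sizep : size p = #|T|.
  by rewrite -(card_uniqP Up); apply: eq_card => z; rewrite p_all.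
have [ce _ _|nce] := boolP (cycle e p); first by exists p; rewrite /ucycle ce.
have [z ez] : exists z, ~~ e z (next p z).
  case: (pickP (fun z => ~~ e z (next p z))) => [z ez|all_e]; first by exists z.
  by case/negP: nce; apply: cycle_from_next => // z _; apply/negPn/negbT/all_e.
wlog [def_x def_y] : x y cp / x = next p z /\ y = z.
  move=> IH nexy deg; have := next_cycle cp (p_all z).
  rewrite /add_edge (negbTE ez) /= => /orP[]/andP[/eqP zx /eqP ny]; last first.
    by apply: (IH x y).
  apply: (IH y x); rewrite // 1?eq_sym // 1?addnC //.
  rewrite (eq_cycle (e' := add_edge x y)) // => a b.
  by rewrite /add_edge [X in _ || X]orbC.
move: def_x def_y cp => -> -> cp nez deg.
have [v ezv exv] : exists2 v, e z v & e (next p z) (next p v).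
  have injn := can_inj (prev_next Up).
  pose Nz := [set v | e z v].
  pose Nx := next p @^-1: [set v | e (next p z) v].
  have [|/set0Pn[v]] := eqVneq (Nz :&: Nx) set0.
    move=> I0; have := subset_leq_card (subsetT (Nz :|: Nx :|: [set z])).
    rewrite cardsU cardsU I0 cards0 cardsT card_preimset // cards1.
    rewrite (_ : (_ :|: _) :&: [set z] = set0) ?cards0.
      by rewrite /Nz; lia.
    apply/setP=> v; rewrite !inE; case: eqP => [->|]; last by rewrite andbF.
    by rewrite !irr_e.
  by rewrite !inE => /andP[? ?]; exists v.
have nzv : z != v by apply: contraTneq ezv => ->; rewrite irr_e.
have [i [q1 [q2 [def_p l1 l2]]]] := cycle_split Up (p_all z) (p_all v) nzv.
have Ur : uniq (rot i p) by rewrite rot_uniq.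
have pe : path e (next p z) (q1 ++ next p v :: q2).
  have lq : last (next p z) (q1 ++ next p v :: q2) = z by rewrite last_cat.
  have sq : size (rot i p) = #|T| by rewrite size_rot.
  apply: path_add_edge; rewrite ?lq.
  - by move: Ur; rewrite def_p.
  - by move: sq T3; rewrite def_p /= => <-.
  - by move: cp; rewrite -(rot_cycle i) def_p cat_cons /= rcons_path => /andP[].
exists ((next p z :: q1) ++ [::] ++ rev (next p v :: q2)); split; last first.
  by move=> t; rewrite cat0s mem_cat mem_rev -mem_cat -def_p mem_rot.
have /and3P[pq1 _ pq2] : [&& path e (next p z) q1,
    e (last (next p z) q1) (next p v) & path e (next p v) q2].
  by move: pe; rewrite cat_path.
by apply: (ucycle_cross sym_e); rewrite ?l1 ?l2 -?def_p //= 1?sym_e.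
Qed.
End Ore.

Lemma ore_closure (T : finType) (e : rel T) (s : seq (T * T)) :
    symmetric e -> irreflexive e -> 2 < #|T| ->
    (forall x y, (x, y) \in s ->
      x != y /\ #|T| <= #|[set z | e x z]| + #|[set z | e y z]|) ->
  ham [rel a b | [|| e a b, (a, b) \in s | (b, a) \in s]] -> ham e.
Proof.
move=> sym_e irr_e T3; elim: s => [|[x y] s IH] deg.
  case=> p [cp p_all]; exists p; split=> //; move: cp.
  by rewrite /ucycle (eq_cycle (e' := e)) // => a b; rewrite /= !orbF.
move=> [p [cp p_all]]; apply: IH => [a b ab|].
  by apply: deg; rewrite in_cons ab orbT.
have [nexy degxy] := deg x y (mem_head _ _).
set e' := [rel a b | _].
apply: (@ore_step _ e' _ _ x y) => //.
- by move=> a b /=; rewrite sym_e [X in _ || X]orbC.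
- move=> a /=; rewrite irr_e orbb /=; apply/negP=> aas.
  by have [] := deg a a; rewrite ?in_cons ?aas ?orbT ?eqxx.
- apply: leq_trans degxy _; rewrite leq_add // subset_leq_card //.
    by apply/subsetP=> z; rewrite !inE /= => ->.
  by apply/subsetP=> z; rewrite !inE /= => ->.
exists p; split=> //; move: cp.
rewrite /ucycle (eq_cycle (e' := add_edge e' x y)) // => a b.
rewrite /add_edge /= !in_cons !xpair_eqE.
case: (e a b) => //=; case: ((a, b) \in s); case: ((b, a) \in s);
  by case: (a == x); case: (b == y); case: (a == y); case: (b == x).
Qed.

(** * A vertex missed by a longest cycle *)

Section Island.
Variables (T : finType) (e : rel T) (p : seq T) (w : T).
Hypothesis (sym_e : symmetric e) (irr_e : irreflexive e).
Hypothesis (ucp : ucycle e p) (wp : w \notin p).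

Definition outer : rel T := [rel a b | [&& e a b, a \notin p & b \notin p]].
Definition island : {set T} := [set u | connect outer w u].
Definition shore : {set T} := [set x in p | [exists u in island, e x u]].

Lemma island_notin u : u \in island -> u \notin p.
Proof.
rewrite inE => /connectP[s + ->]; elim/last_ind: s => [|s t _] //.
by rewrite rcons_path last_rcons => /and4P[].
Qed.

Lemma island_step u v : u \in island -> v \notin p -> e u v -> v \in island.
Proof.
move=> uI vp euv; have := uI; rewrite !inE => wu.
by apply: connect_trans wu (connect1 _); rewrite /outer /= euv vp island_notin.
Qed.

Lemma detour_shore x y : x \in shore -> y \in shore -> detour e p x y.
Proof.
rewrite !inE => /andP[xp /existsP[u /andP[uI exu]]].
move=> /andP[yp /existsP[v /andP[vI eyv]]].
have sym_o : connect_sym outer.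
  by apply: sym_connect_sym => a b; rewrite /outer /= sym_e [X in _ && X]andbC.
have : connect outer u v.
  by move: uI vI; rewrite !inE => wu; apply: connect_trans; rewrite sym_o.
case/connectP=> s0 /shortenP[s us Us _ lv].
exists u, s; split=> //.
- by apply: sub_path us => a b /= /andP[].
- by rewrite sym_e -lv.
rewrite cat_uniq Us /=; have /andP[_ ->] := ucp; rewrite andbT.
apply/hasPn=> z zp; apply/negP=> zs; move: zp; apply/negP.
apply: island_notin; move: uI; rewrite !inE => wu; apply: connect_trans wu _.
exact: (path_connect us).
Qed.

Hypothesis longest :
  forall p', ucycle e p' -> {subset p <= p'} -> size p' <= size p.

Lemma shore_next x : x \in shore -> next p x \notin shore.
Proof.
move=> xA; apply/negP=> yA; have := detour_shore xA yA.
by apply: no_insertion => //; move: xA; rewrite inE => /andP[].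
Qed.

Lemma shore_next_independent x y :
  x \in shore -> y \in shore -> ~~ e (next p x) (next p y).
Proof.
move=> xA yA; have [->|nexy] := eqVneq x y; first by rewrite irr_e.
have [xp yp] : x \in p /\ y \in p.
  by move: xA yA; rewrite !inE => /andP[-> _] /andP[-> _].
by apply: no_crossing => //; apply: detour_shore.
Qed.
End Island.

(** * Linking short paths through a clique *)

Section Chain.
Variables (T : finType) (e : rel T) (L Q : {set T}) (h : T * bool -> T).
Hypothesis sym_e : symmetric e.
Hypothesis cliqueQ : {in Q &, forall x y, x != y -> e x y}.
Hypothesis disjLQ : {in L, forall x, x \notin Q}.
Hypothesis hQ : forall x b, x \in L -> h (x, b) \in Q.
Hypothesis e_h : forall x b, x \in L -> e x (h (x, b)).
Hypothesis inj_h :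
  forall x y b c, x \in L -> y \in L -> h (x, b) = h (y, c) -> x = y /\ b = c.

Definition chain (s : seq T) : seq T :=
  flatten [seq [:: h (x, true); x; h (x, false)] | x <- s].

Lemma mem_chain s z : z \in chain s ->
  z \in s \/ exists2 x, x \in s & exists b, z = h (x, b).
Proof.
case/flattenP=> _ /mapP[x xs ->]; rewrite !inE.
case/or3P=> /eqP->; [right|by left|right]; exists x => //.
  by exists true.
by exists false.
Qed.

Lemma uniq_chain s : {subset s <= L} -> uniq s -> uniq (chain s).
Proof.
elim: s => // x s IH sL /= /andP[xs Us].
have xL : x \in L by apply: sL; rewrite mem_head.
have s'L : {subset s <= L} by move=> y ys; apply: sL; rewrite inE ys orbT.
have nLh y z b : y \in L -> z \in L -> y != h (z, b).
  by move=> /disjLQ yQ zL; apply: contraNneq yQ => ->; apply: hQ.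
have h_chain b : h (x, b) \notin chain s.
  apply/negP=> /mem_chain[fs|[y ys [c /inj_h]]].
    by have := nLh _ _ b (s'L _ fs) xL; rewrite eqxx.
  by case=> // [|xy _]; [apply: s'L | rewrite xy ys in xs].
have x_chain : x \notin chain s.
  apply/negP=> /mem_chain[|[y ys [c xE]]]; first by rewrite (negbTE xs).
  by have := nLh _ _ c xL (s'L _ ys); rewrite -xE eqxx.
have htf : h (x, true) != h (x, false) by apply/eqP=> /inj_h[].
rewrite -/(chain s) !inE !negb_or !h_chain x_chain htf !nLh //.
by rewrite eq_sym nLh // IH.
Qed.

Lemma chain_path s z : {subset s <= L} -> z \in Q -> uniq (z :: chain s) ->
  path e z (chain s) /\ last z (chain s) \in Q.
Proof.
elim: s z => [|x s IH] z sL zQ //= /and4P[+ _ _ /andP[gs Us]].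
have xL : x \in L by apply: sL; rewrite mem_head.
rewrite !inE !negb_or => /andP[zf _].
have [|||-> ->] := IH (h (x, false)); rewrite ?hQ //= ?gs //.
  by move=> y ys; apply: sL; rewrite inE ys orbT.
by rewrite cliqueQ ?hQ // sym_e !e_h.
Qed.

Lemma chain_cycle s : {subset s <= L} -> uniq s -> ucycle e (chain s).
Proof.
move=> sL /(uniq_chain sL) Us; rewrite /ucycle Us andbT.
case: s sL Us => // x s sL Us.
have xL : x \in L by apply: sL; rewrite mem_head.
have /= /and4P[+ _ gs Us'] := Us; rewrite !inE !negb_or => /and3P[fx fg fs].
have [|||ps ls] := @chain_path s (h (x, false)); rewrite ?hQ //= ?gs //.
  by move=> y ys; apply: sL; rewrite inE ys orbT.
rewrite rcons_path sym_e !e_h // ps /= cliqueQ ?hQ //.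
have : last (h (x, false)) (chain s) \in h (x, false) :: chain s.
  exact: mem_last.
by apply: contraTneq => ->; rewrite inE negb_or fg.
Qed.
End Chain.

(** * Toughness *)

Definition nbrs (G : sgraph) (x : G) : {set G} := [set y | adj x y].

(** Vertices in different components, witnessed in the simplest way: in any two
    of them at least one is isolated once [S] is removed. *)
Lemma num_components_ge (G : sgraph) (S J K : {set G}) :
    {in J, forall x, nbrs x \subset S} -> K \subset ~: S ->
    {in K &, forall x y, x != y -> (x \in J) || (y \in J)} ->
  #|K| <= num_components (delete_vertices S).
Proof.
move=> isoJ KS sepK; set H := delete_vertices S.
pose K' := [set x : H | val x \in K].
have -> : #|K| = #|K'|.
  rewrite -(card_imset _ (val_inj : injective (val : H -> G))); apply: eq_card => x.
  apply/idP/imsetP => [xK|[x' + ->]]; last by rewrite inE.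
  by exists (Sub x (subsetP KS x xK) : H); rewrite ?inE SubK.
have symH : connect_sym (@adj H) by apply: sym_connect_sym; apply: adj_sym.
have stuck (x y : H) : val x \in J -> connect (@adj H) x y -> x = y.
  move=> xJ /connectP[[|z s]] //= /andP[xz _] _.
  have := subsetP (isoJ _ xJ) (val z); rewrite inE => /(_ xz).
  by have := valP z; rewrite inE => /negbTE->.
have injK : {in K' &, injective (fingraph.root (@adj H))}.
  move=> x y; rewrite !inE => xK yK /eqP; rewrite (root_connect symH) => xy.
  apply/eqP; case: eqVneq => // nexy; have := sepK _ _ xK yK.
  rewrite (inj_eq val_inj) => /(_ nexy) /orP[xJ|yJ].
    by rewrite (stuck _ _ xJ xy) eqxx in nexy.
  by rewrite symH in xy; rewrite (stuck _ _ yJ xy) eqxx in nexy.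
rewrite -(card_in_imset injK) /num_components /n_comp_mem subset_leq_card //.
by apply/subsetP=> _ /imsetP[x _ ->]; rewrite inE /= roots_root.
Qed.

(** The vertices of [J] are isolated once [S] is removed.  A single isolated
    vertex already counts, provided that something else is left. *)
Lemma tough_isolated (R : realType) (k : nat) (G : sgraph) (J S : {set G}) :
    tough (k%:R : R) G -> J \subset ~: S ->
    {in J, forall x, nbrs x \subset S} -> 1 < #|~: S| ->
  k * #|J| <= #|S|.
Proof.
move=> toughG JS isoJ S2.
have [->|[j jJ]] := set_0Vmem J; first by rewrite cards0 muln0.
have c_J : #|J| <= num_components (delete_vertices S).
  by apply: num_components_ge isoJ _ _ => // x y ->.
have c_2 : 2 <= num_components (delete_vertices S).
  have [z] : exists z, z \in ~: S :\ j.
    apply/set0Pn; rewrite -card_gt0; move: S2.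
    by rewrite (cardsD1 j) (subsetP JS).
  rewrite in_setD1 => /andP[nzj zS].
  have <- : #|[set j; z]| = 2 by rewrite cards2 eq_sym nzj.
  apply: num_components_ge isoJ _ _.
    by rewrite subUset !sub1set (subsetP JS).
  by move=> x y; rewrite !inE => /orP[]/eqP-> /orP[]/eqP->;
    rewrite ?jJ ?orbT ?eqxx.
have := toughG S c_2; rewrite -natrM ler_nat; apply: leq_trans.
by rewrite leq_mul2l c_J orbT.
Qed.

Section Tough.
Variables (R : realType) (G : sgraph).
Hypothesis (toughG : tough (3%:R : R) G) (freeG : two_K2_free G).

(** Separating two non-adjacent vertices takes at least six others. *)
Lemma complete_or_large : (forall x y : G, x != y -> adj x y) \/ 4 <= #|G|.
Proof.
have [/forallP cG|/forallPn[x /forallPn[y]]] :=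
  boolP [forall x : G, forall y, (x != y) ==> adj x y].
  by left=> x y nexy; have /forallP/(_ y) := cG x; rewrite nexy.
rewrite negb_imply => /andP[nexy nxy]; right.
have c2 : #|[set x; y]| = 2 by rewrite cards2 nexy.
have := @tough_isolated R 3 G [set x; y] (~: [set x; y]) toughG.
rewrite setCK subxx c2 cardsCs setCK c2 => /(_ isT).
suff iso : {in [set x; y], forall z, nbrs z \subset ~: [set x; y]}.
  by move/(_ iso isT); lia.
move=> z zxy; apply/subsetP=> t; rewrite !inE; apply: contraTN.
by move: zxy; rewrite !inE => /orP[]/eqP-> /orP[]/eqP->;
  rewrite ?adj_irrefl // adj_sym.
Qed.

(* On three vertices, a single one already exceeds a quarter of the graph. *)
Hypothesis G4 : 4 <= #|G|.

Lemma independent_card (J : {set G}) :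
  {in J &, forall x y, ~~ adj x y} -> 4 * #|J| <= #|G|.
Proof.
move=> indJ; have [J1|J2] := leqP #|J| 1; first by lia.
have := @tough_isolated R 3 G J (~: J) toughG; rewrite setCK subxx => /(_ isT) h.
have /h/(_ J2) : {in J, forall x, nbrs x \subset ~: J}.
  move=> x xJ; apply/subsetP=> y; rewrite !inE.
  by apply: contraTN => /(indJ _ _ xJ).
by have := cardsC J; lia.
Qed.

Lemma adj_neq (x y : G) : adj x y -> x != y.
Proof. by apply: contraTneq => ->; rewrite adj_irrefl. Qed.

(** The common non-neighbours of [x] and [y] are independent: an edge between
    two of them would form an induced [2K_2] with the edge from [x] to [y]. *)
Lemma edge_degrees (x y : G) :
  adj x y -> 3 * #|G| <= 4 * (#|nbrs x| + #|nbrs y|).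
Proof.
move=> xy; have : {in ~: (nbrs x :|: nbrs y) &, forall a b, ~~ adj a b}.
  move=> a b; rewrite !inE !negb_or => /andP[xa ya] /andP[xb yb]; apply/negP=> ab.
  case: freeG; exists x, y, a, b; split=> //=; rewrite !inE !negb_or.
  have nxa : x != a by apply: contraNneq ya => <-; rewrite adj_sym.
  have nxb : x != b by apply: contraNneq yb => <-; rewrite adj_sym.
  have nya : y != a by apply: contraNneq xa => <-.
  have nyb : y != b by apply: contraNneq xb => <-.
  by rewrite (adj_neq xy) (adj_neq ab) nxa nxb nya nyb.
move/independent_card; have := cardsC (nbrs x :|: nbrs y).
by have := (cardsU (nbrs x) (nbrs y)); lia.
Qed.

(** * Light and heavy vertices *)

Definition light : {set G} := [set x | 4 * #|nbrs x| <= #|G|].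
Definition heavy : {set G} := [set x | #|G| <= 2 * #|nbrs x|].

Lemma light_heavy x : x \in light -> x \notin heavy.
Proof. by rewrite !inE; lia. Qed.

Lemma light_nbrs x : x \in light -> nbrs x \subset heavy.
Proof.
move=> xL; apply/subsetP=> y; move: xL; rewrite !inE => xL /edge_degrees.
by lia.
Qed.

Definition heavy_adj : rel G :=
  [rel x y | adj x y || [&& x != y, x \in heavy & y \in heavy]].

Lemma heavy_adj_sym : symmetric heavy_adj.
Proof.
move=> x y; rewrite /heavy_adj /=.
by rewrite adj_sym eq_sym [(x \in _) && _]andbC.
Qed.

Lemma heavy_adj_irrefl : irreflexive heavy_adj.
Proof. by move=> x; rewrite /heavy_adj /= adj_irrefl eqxx. Qed.

(** Hall's theorem applied to two copies of each light vertex. *)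
Lemma private_nbrs : exists h : G * bool -> G,
  (forall x b, x \in light -> adj x (h (x, b))) /\
  (forall x y b c, x \in light -> y \in light -> h (x, b) = h (y, c) ->
     x = y /\ b = c).
Proof.
have /card_gt0P[y0 _] : 0 < #|G| by apply: leq_trans G4.
pose N (xb : G * bool) := nbrs xb.1.
have [S SL|h [injh hN]] := @hall _ _ y0 N [set xb | xb.1 \in light].
  pose P := [set xb.1 | xb in S].
  have PL : P \subset light.
    by apply/subsetP=> _ /imsetP[xb /(subsetP SL) + ->]; rewrite inE.
  have leSP : #|S| <= 2 * #|P|.
    rewrite -card_bool mulnC -cardsT -cardsX subset_leq_card //.
    by apply/subsetP=> xb xbS; rewrite !inE imset_f.
  apply: (leq_trans leSP).
  have -> : \bigcup_(xb in S) N xb = \bigcup_(x in P) nbrs x.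
    apply/setP=> y; apply/bigcupP/bigcupP=> [[xb xbS yN]|].
      by exists xb.1; rewrite ?imset_f.
    by case=> _ /imsetP[xb xbS ->] yN; exists xb.
  set NP := \bigcup_(x in P) nbrs x.
  have PN : P \subset ~: NP.
    apply/subsetP=> x /(subsetP PL)/light_heavy; rewrite in_setC; apply: contra.
    by case/bigcupP=> y /(subsetP PL)/light_nbrs/subsetP; apply.
  have isoP : {in P, forall x, nbrs x \subset NP}.
    by move=> x xP; apply: (bigcup_sup x).
  suff : 1 < #|~: NP| by move/(tough_isolated toughG PN isoP); lia.
  have [P2|P1] := ltnP 1 #|P|.
    exact: leq_trans P2 (subset_leq_card PN).
  (* The neighbourhood of a single light vertex leaves most of the graph. *)
  have leNP : 4 * #|NP| <= #|G|.
    have [P0|[x xP]] := set_0Vmem P; first by rewrite /NP P0 big_set0 cards0; lia.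
    have /eqP eqP : [set x] == P by rewrite eqEcard sub1set xP cards1.
    by rewrite /NP -eqP big_set1; have := subsetP PL x xP; rewrite inE.
  by have := cardsC NP; lia.
exists h; split=> [x b xL|x y b c xL yL /injh eqh].
  have : h (x, b) \in nbrs x by apply: hN; rewrite inE.
  by rewrite inE.
suff [] : (x, b) = (y, c) by [].
by apply: eqh; rewrite in_set.
Qed.

Lemma cycle_through_light :
  exists2 p, ucycle heavy_adj p & {in light, forall x, x \in p}.
Proof.
have [h [adjh injh]] := private_nbrs.
exists (chain h (enum light)).
  apply: (@chain_cycle _ _ light heavy) => //; last exact: enum_uniq.
  - exact: heavy_adj_sym.
  - by move=> x y xQ yQ nexy; rewrite /heavy_adj /= nexy xQ yQ orbT.
  - exact: light_heavy.
  - move=> x b xL; apply: (subsetP (light_nbrs xL)).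
    by rewrite inE adjh.
  - by move=> x b xL; rewrite /heavy_adj /= adjh.
  - by move=> x; rewrite mem_enum.
move=> x xL; apply/flattenP.
exists [:: h (x, true); x; h (x, false)]; last by rewrite !inE eqxx orbT.
by apply: map_f; rewrite mem_enum.
Qed.

(** [I] is the component of the missed vertex [w] outside [p], [A] its set of
    neighbours on [p], and [B] the set of successors of [A].  The graph turns out
    to consist, on [p], of [A] and of the independent set [B], alternating. *)
Lemma longest_spanning p :
    ucycle heavy_adj p -> {in light, forall x, x \in p} ->
    (forall p', ucycle heavy_adj p' -> {subset p <= p'} -> size p' <= size p) ->
  forall w, w \in p.
Proof.
move=> ucp Lp longest w; apply/negPn/negP=> wp.
have /andP[cp Up] := ucp.
pose I := island heavy_adj p w; pose A := shore heavy_adj p w.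
pose B : {set G} := [set next p x | x in A].
have adjW (x y : G) : adj x y -> heavy_adj x y by rewrite /heavy_adj /= => ->.
have wI : w \in I by rewrite inE connect0.
have Ap x : x \in A -> x \in p by rewrite inE => /andP[].
have shoreI x u : x \in p -> u \in I -> heavy_adj x u -> x \in A.
  by move=> xp uI xu; rewrite inE xp; apply/existsP; exists u; rewrite uI.
have BpnA y : y \in B -> y \in p /\ y \notin A.
  case/imsetP=> x xA ->; rewrite mem_next Ap //; split=> //.
  exact: (shore_next heavy_adj_sym ucp wp longest).
have cardB : #|B| = #|A| by rewrite card_imset //; apply: can_inj (prev_next Up).
have wB : w \notin B by apply: contra wp => /BpnA[].
have A_small : 4 * #|A| < #|G|.
  suff : {in w |: B &, forall x y, ~~ adj x y}.
    by move/independent_card; rewrite cardsU1 wB cardB; lia.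
  have wBn y : y \in B -> ~~ adj w y.
    case/BpnA=> yp; apply: contra; rewrite adj_sym => /adjW; exact: shoreI.
  move=> x y /setU1P[->|xB] /setU1P[->|yB]; rewrite ?adj_irrefl ?wBn //.
    by rewrite adj_sym wBn.
  move: xB yB => /imsetP[x' xA ->] /imsetP[y' yA ->]; apply: contra (@adjW _ _) _.
  exact: (shore_next_independent heavy_adj_sym heavy_adj_irrefl ucp wp longest).
have [v wv vA] : exists2 v, adj w v & v \notin A.
  have : ~~ (nbrs w \subset A).
    (* [w] is not light, so it has more neighbours than [A] has elements. *)
    apply/negP=> /subset_leq_card; have := contra (Lp w) wp.
    by rewrite inE; lia.
  by case/subsetPn=> v; rewrite inE; exists v.
have vp : v \notin p.
  by apply: contra vA => vp; apply: (shoreI v w) => //; rewrite adjW // adj_sym.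
have vI : v \in I by exact: (island_step wp wI vp (adjW _ _ wv)).
(* An edge leaving [q] is disjoint from and, unless it ends in [A], not joined
   to the edge from [w] to [v]. *)
have nbrs_inland q : q \in p -> q \notin A -> nbrs q \subset A.
  move=> qp qA; apply/subsetP=> r; rewrite inE => qr; apply/negPn/negP=> rA.
  have rI : r \notin I.
    by apply: contra qA => rI; apply: (shoreI q r) => //; apply: adjW.
  have nqI u : u \in I -> ~~ adj q u.
    by move=> uI; apply: contra qA => /adjW; apply: shoreI.
  have nrI u : u \in I -> ~~ adj r u.
    move=> uI; apply/negP=> ru; have [rp|rp] := boolP (r \in p).
      by rewrite (shoreI r u) ?adjW in rA.
    by rewrite (island_step wp uI rp) ?adjW // adj_sym in rI.
  apply: freeG; exists q, r, w, v; split=> //; last by split; rewrite ?nqI ?nrI.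
  rewrite /= !inE !negb_or (adj_neq qr) (adj_neq wv) /=.
  have apart t u : t \notin I -> u \in I -> t != u.
    by move=> + uI; apply: contraNneq => ->.
  have qI : q \notin I by apply: contraTN qp => /(island_notin wp).
  by rewrite !apart.
(* Such a [q] has degree at most the size of [A], hence is light; the edge of [p]
   arriving at [q] is then an edge of the original graph. *)
have inland q : q \in p -> q \notin A -> q \in B.
  move=> qp qA; have qL : q \in light.
    by have := subset_leq_card (nbrs_inland q qp qA); rewrite inE; lia.
  apply/imsetP; exists (prev p q); last by rewrite next_prev.
  apply: (subsetP (nbrs_inland q qp qA)); rewrite inE adj_sym.
  have := prev_cycle cp qp; rewrite /heavy_adj /= => /orP[//|/and3P[_ _ qQ]].
  by have := light_heavy qL; rewrite qQ.
(* If [p] were empty, the edge from [w] to [v] would be a longer closed sequence. *)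
have B_gt0 : 0 < #|B|.
  case def_p: p => [|q s]; last first.
    have qp : q \in p by rewrite def_p mem_head.
    apply/card_gt0P; have [qA|qA] := boolP (q \in A).
      by exists (next p q); apply: imset_f.
    by exists q; apply: inland.
  have nwv := adj_neq wv.
  suff : size [:: w; v] <= size p by rewrite def_p.
  apply: longest; last by rewrite def_p.
  by rewrite /ucycle /= inE nwv !adjW // adj_sym.
have : 3 * #|B| <= #|A|.
  apply: tough_isolated toughG _ _ _.
  - by apply/subsetP=> y /BpnA[_ yA]; rewrite inE.
  - by move=> y /BpnA[]; apply: nbrs_inland.
  have : w |: B \subset ~: A.
    apply/subsetP=> y; rewrite in_setC => /setU1P[->|/BpnA[]//].
    by apply: contra wp; apply: Ap.
  by move/subset_leq_card; rewrite cardsU1 wB; lia.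
by rewrite cardB in B_gt0 *; lia.
Qed.

Lemma ham_of_tough : ham (@adj G).
Proof.
have [p0 ucp0 Lp0] := cycle_through_light.
pose good k := [exists t : k.-tuple G,
  [&& cycle heavy_adj t, uniq t & light \subset t]].
have ex_good : exists k, good k.
  exists (size p0); apply/existsP; exists (in_tuple p0).
  by have /andP[-> ->] := ucp0; apply/subsetP.
have good_le k : good k -> k <= #|G|.
  case/existsP=> t /and3P[_ Ut _]; rewrite -(size_tuple t) -(card_uniqP Ut).
  exact: max_card.
case: (ex_maxnP ex_good good_le) => k /existsP[t /and3P[ct Ut Lt]] max_k.
have spanning w : w \in t.
  apply: (longest_spanning (p := t)) => [||p' ucp' tp'].
    by rewrite /ucycle ct.
    exact/subsetP.
  rewrite size_tuple; apply: max_k; apply/existsP; exists (in_tuple p').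
  have /andP[-> ->] := ucp'; apply/subsetP=> x xL; apply: tp'.
  exact: (subsetP Lt).
pose s := [seq xy <- enum [set: G * G] |
  [&& xy.1 != xy.2, xy.1 \in heavy & xy.2 \in heavy]].
have in_s x y : ((x, y) \in s) = [&& x != y, x \in heavy & y \in heavy].
  by rewrite mem_filter mem_enum in_setT andbT.
have deg_s x y : (x, y) \in s -> x != y /\ #|G| <= #|nbrs x| + #|nbrs y|.
  by rewrite in_s !inE => /and3P[-> xQ yQ]; split=> //; lia.
apply: (ore_closure (@adj_sym G) (@adj_irrefl G) (ltnW G4) deg_s).
exists t; split=> //; rewrite /ucycle Ut andbT.
rewrite -(eq_cycle (e := heavy_adj)) // => x y.
by rewrite /= !in_s /heavy_adj /= eq_sym [(y \in _) && _]andbC orbb.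
Qed.
End Tough.

Theorem theorem1 (R : realType) (G : sgraph) :
  (3 <= #|G|)%N -> tough (3%:R : R) G -> two_K2_free G -> hamiltonian G.
Proof.
move=> G3 toughG freeG.
suff [p [ucp p_all]] : ham (@adj G).
  exists p; split=> //; split=> //; have /andP[_ Up] := ucp.
  by rewrite -(card_uniqP Up) (eq_card (B := G)) // => x; rewrite p_all.
have [cG|G4] := complete_or_large toughG.
  exists (enum G); split=> [|x]; last by rewrite mem_enum.
  apply: ucycle_complete => //; first exact: enum_uniq.
  by rewrite -cardE ltnW.
exact: (ham_of_tough toughG freeG G4).
Qed.
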